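(* Every normal weight $v$ on $\mathbb{D}$, and every exponential weight $v$ of type $(\alpha,\beta)$ with $\alpha>0$, $\beta>0$, satisfies condition $(B)$ and also the following condition: there is some $\epsilon>0$ with $$\sup_{n=1,2,\ldots}\frac{\int_0^1 r^{n-n^{\epsilon}}v(r)\,dr}{\int_0^1 r^n v(r)\,dr}<\infty .$$
   Context: $\mathbb{D}$ is the open unit disc of $\mathbb{C}$. A weight $v$ on $\mathbb{D}$ is a continuous strictly positive function with $v(z)=v(|z|)$ for all $z\in\mathbb{D}$, $\lim_{|z|\to1}v(z)=0$ and $v(r)\ge v(s)$ if $0<r<s<1$. A weight $v$ is normal if $$\sup_{n\in\mathbb{N}}\frac{v(1-2^{-n})}{v(1-2^{-n-1})}<\infty\quad\text{and}\quad \inf_{k\in\mathbb{N}}\limsup_{n\to\infty}\frac{v(1-2^{-n-k})}{v(1-2^{-n})}<1 .$$ A weight $v$ is exponential of type $(\alpha,\beta)$, where $\alpha,\beta>0$, if $v(r)=\exp(-\alpha/(1-r)^\beta)$ for all $r\in[0,1[$. Condition $(B)$: for each (real) $m>0$ let $r_m$ be a point where $r\mapsto r^mv(r)$ attains its absolute maximum on $[0,1]$ (with $v(1)=0$). The weight $v$ satisfies $(B)$ if $$\forall b_1>1\ \exists b_2>1\ \exists c>0\ \forall m,n>0:\quad \Big(\frac{r_m}{r_n}\Big)^m\frac{v(r_m)}{v(r_n)}\le b_1\ \text{ and }\ m,n,|m-n|\ge c\ \Rightarrow\ \Big(\frac{r_n}{r_m}\Big)^n\frac{v(r_n)}{v(r_m)}\le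 b_2 ,$$ where $m,n$ are real numbers, not necessarily integers. *)

(* Defs.v *)
From mathcomp Require Export all_boot all_order all_algebra complex.
From mathcomp Require Export all_classical all_reals all_analysis.
Export numFieldNormedType.Exports.
Export Order.TTheory GRing.Theory Num.Theory.

Set Implicit Arguments.
Unset Strict Implicit.
Unset Printing Implicit Defensive.

Local Open Scope classical_set_scope.
Local Open Scope ring_scope.
Local Open Scope complex_scope.

(* Functions on the disc are represented by total functions on R[i]^o, the
   complex plane with its normed topology; values outside the disc are
   irrelevant. *)
Definition disc (R : realType) : set (R[i]^o) := [set z | `|z| < 1].

(* The filter "|z| -> 1 with z in the disc". *)
Definition to_circle (R : realType) : set_system (R[i]^o) :=
  filter_from [set d : R | 0 < d]
    (fun d => [set z : R[i]^o | (1 - d)%:C < `|z| < 1]).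

Definition is_weight (R : realType) (v : R[i]^o -> R) : Prop :=
  [/\ {within @disc R, continuous v},
      forall z, disc z -> 0 < v z,
      forall z, disc z -> v z = v `|z|,
      v z @[z --> @to_circle R] --> (0 : R)
    & forall r s : R, 0 < r -> r < s -> s < 1 -> v s%:C <= v r%:C].

Definition is_normal (R : realType) (v : R[i]^o -> R) : Prop :=
  (ereal_sup [set (v (1 - 2 ^- n)%:C / v (1 - 2 ^- n.+1)%:C)%:E
             | n in [set: nat]] < +oo)%E /\
  (ereal_inf [set limn_esup
                (fun n => (v (1 - 2 ^- (n + k))%:C / v (1 - 2 ^- n)%:C)%:E)
             | k in [set: nat]] < 1%:E)%E.

Definition is_exponential (R : realType) (alpha beta : R) (v : R[i]^o -> R) :
    Prop :=
  forall r : R, 0 <= r < 1 -> v r%:C = expR (- (alpha / (1 - r) `^ beta)).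

(* The restriction of v to [0, 1[, extended by the convention v(1) = 0. *)
Definition profile (R : realType) (v : R[i]^o -> R) (r : R) : R :=
  if r < 1 then v r%:C else 0.

Definition max_points (R : realType) (v : R[i]^o -> R) (r_ : R -> R) : Prop :=
  forall m : R, 0 < m -> 0 <= r_ m <= 1 /\
    forall s : R, 0 <= s <= 1 ->
      s `^ m * profile v s <= r_ m `^ m * profile v (r_ m).

(* Maximum points need not be unique; the condition is required for every
   choice of them. *)
Definition condition_B (R : realType) (v : R[i]^o -> R) : Prop :=
  forall r_ : R -> R, max_points v r_ ->
  forall b1 : R, 1 < b1 -> exists b2 c : R, [/\ 1 < b2, 0 < c &
    forall m n : R, 0 < m -> 0 < n ->
      (r_ m / r_ n) `^ m * (profile v (r_ m) / profile v (r_ n)) <= b1 ->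
      c <= m -> c <= n -> c <= `|m - n| ->
      (r_ n / r_ m) `^ n * (profile v (r_ n) / profile v (r_ m)) <= b2].

Definition moment (R : realType) (v : R[i]^o -> R) (a : R) : \bar R :=
  (\int[lebesgue_measure]_(r in `[0%R, 1%R]) (r `^ a * profile v r)%:E)%E.

(* Moments are extended-real, so exponents n - n^epsilon <= -1 with a divergent
   integral do not satisfy the bound by accident. *)
Definition moment_condition (R : realType) (v : R[i]^o -> R) : Prop :=
  exists2 epsilon : R, 0 < epsilon &
    (ereal_sup [set moment v (n%:R - n%:R `^ epsilon) / moment v n%:R
               | n in [set n : nat | (0 < n)%N]] < +oo)%E.

(* Main.v *)
Require Import Defs.
From mathcomp Require Import zify ring lra measurable_realfun.

(* Condition (B), normal weights: doubling and decay at dyadic points confine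
   every t with (1 - t)^m v(1 - t) >= kappa v(1 - 1/m) to c <= m t <= C.  This
   applies to t = 1 - r_m, and, under the hypothesis of (B), also to
   t = 1 - r_n, so 1 - r_m, 1 - r_n, 1/m and 1/n are all comparable.

   Condition (B), exponential weights: with r = exp(-x) and v = exp(-u), r_m
   corresponds to the x with -u'(x) = m, and the two ratios in (B) are the
   exponentials of the Bregman divergences of the convex function u between x_m
   and x_n.  As u'' is decreasing, doubling and >> x^(-2) near 0, a bound on one
   divergence forces x_n >= x_m / 2 and bounds the other.

   Moments: both kinds of weights satisfy v(1 - t) >= c exp(-alpha t^(-beta)),
   whence int r^n v >= c' exp(-n^(1-epsilon)) for
   epsilon = 1 / (2 (beta + 1)), and this dominates the part of
   int r^(n - n^epsilon) v over r <= exp(-n^(-epsilon)). *)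

Set Implicit Arguments.
Unset Strict Implicit.
Unset Printing Implicit Defensive.

Local Open Scope classical_set_scope.
Local Open Scope ring_scope.
Local Open Scope complex_scope.

(** * Radial profiles *)

Lemma disc_real (R : realType) (r : R) : 0 <= r -> r < 1 -> @disc R r%:C.
Proof.
move=> r0 r1; rewrite /disc /= ger0_norm; last by rewrite lecR.
by rewrite -[1]/(1%:C) ltcR.
Qed.

Lemma open_disc (R : realType) : open (@disc R).
Proof.
have -> : @disc R = ball (0 : R[i]^o) 1.
  by apply/seteqP; split=> z; rewrite /disc -ball_normE /= sub0r normrN.
exact: ball_open.
Qed.

(* [is_weight] gives monotonicity on ]0, 1[ only; continuity extends it to 0. *)
Lemma weight_le0 (R : realType) (v : R[i]^o -> R) (s : R) :
  is_weight v -> 0 < s -> s < 1 -> v s%:C <= v 0%:C.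
Proof.
move=> [cv _ _ _ mono] s0 s1; rewrite leNgt; apply/negP => lt0s.
have d0 : (0 : R[i]^o) \in @disc R.
  by rewrite inE; apply: disc_real => //; exact: ltr01.
move: cv; rewrite continuous_open_subspace; last exact: open_disc.
move=> /(_ _ d0) /cvgrPdist_lt /(_ (v s%:C - v 0%:C)).
rewrite subr_gt0 => /(_ lt0s) /nbhs_ballP[e /= e0 He].
(* Radii of balls in [R[i]^o] are complex numbers; positivity in the order of [R[i]] makes [e]
   real. *)
have [er ei] : 0 < complex.Re e /\ complex.Im e = 0.
  by move: e0; rewrite ltcE /= => /andP[/eqP -> ->].
pose r := Num.min (s / 2) (complex.Re e / 2).
have r0 : 0 < r by rewrite lt_min !divr_gt0.
have rs : r < s by rewrite gt_min; apply/orP; left; lra.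
have re : r < complex.Re e by rewrite gt_min; apply/orP; right; lra.
have /He {He} : ball (0 : R[i]^o) e r%:C.
  rewrite -ball_normE /= sub0r normrN ger0_norm; last by rewrite lecR ltW.
  by clearbody r; case: e {e0 He er} ei re => a b /= -> ?; rewrite ltcR.
have := mono _ _ r0 rs s1.
move=> h1 /=; rewrite distrC => /(le_lt_trans (ler_norm _)).
by rewrite ltrD2r ltNge h1.
Qed.

Lemma profile_gt0 (R : realType) (v : R[i]^o -> R) (r : R) :
  is_weight v -> 0 <= r -> r < 1 -> 0 < profile v r.
Proof.
by move=> [_ pos _ _ _] r0 r1; rewrite /profile r1; apply/pos/disc_real.
Qed.

Lemma profile_ge0 (R : realType) (v : R[i]^o -> R) (r : R) :
  is_weight v -> 0 <= r -> 0 <= profile v r.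
Proof.
move=> hv r0; have [r1|r1] := ltP r 1; first by rewrite ltW// profile_gt0.
by rewrite /profile ltNge r1.
Qed.

Lemma profile_le (R : realType) (v : R[i]^o -> R) (r s : R) :
  is_weight v -> 0 <= r -> r <= s -> profile v s <= profile v r.
Proof.
move=> hv r0 rs; have [s1|s1] := ltP s 1; last first.
  by rewrite {1}/profile ltNge s1 profile_ge0.
rewrite /profile s1 (le_lt_trans rs s1).
move: rs; rewrite le_eqVlt => /predU1P[->//|rs].
move: r0; rewrite le_eqVlt => /predU1P[r0|r0].
  by rewrite -r0 weight_le0// r0.
by case: hv => _ _ _ _; exact.
Qed.

Lemma measurable_profile (R : realType) (v : R[i]^o -> R) :
  is_weight v -> measurable_fun (`[0, 1] : set R) (profile v).
Proof.
(* Clamping the argument at 0 gives a function that is nonincreasing on the whole line and agrees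
   with the profile on [0, 1]. *)
move=> hv; pose g (r : R) := profile v (Num.max 0 r).
apply: (eq_measurable_fun g).
  by move=> r; rewrite inE /= in_itv /= => /andP[r0 _]; rewrite /g max_r.
apply: nonincreasing_measurable => // r s rs /=.
apply: profile_le => //; first by rewrite le_max lexx.
by rewrite ge_max !le_max lexx/= rs orbT.
Qed.

(** * Exponential weights *)

(** Mean value theorem, with the intermediate slope bounded by monotonicity of [g]. It serves twice:
    for [u] with slope [p], and for [p] with slope [q]. *)
Lemma decreasing_slope (R : realType) (f g : R -> R) :
    (forall x : R, 0 < x -> is_derive x 1 f (- g x)) ->
    (forall x y : R, 0 < x -> x <= y -> g y <= g x) ->
  forall x y : R, 0 < x -> x <= y ->
    g y * (y - x) <= f x - f y <= g x * (y - x).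
Proof.
move=> df gdecr x y x0; rewrite le_eqVlt => /predU1P[<-|xy].
  by rewrite !subrr !mulr0 lexx.
have [||c] := MVT (f := f) (df := fun x => - g x) xy.
- by move=> z; rewrite in_itv /= => /andP[xz _]; apply/df/(lt_trans x0 xz).
- apply: derivable_within_continuous => z; rewrite in_itv /= => /andP[xz _].
  by have /df[] := lt_le_trans x0 xz.
rewrite in_itv /= => /andP[xc cy] E.
have -> : f x - f y = g c * (y - x) by rewrite -opprB E mulNr opprK.
have yx0 : 0 <= y - x by rewrite subr_ge0 ltW.
by rewrite !ler_wpM2r// gdecr// ?ltW// (lt_trans x0 xc).
Qed.

(* The two bounded quantities are the Bregman divergences of u at (x, y) and
   (y, x); they sum to (p x - p y) * (y - x). *)
Lemma bregman_swap (R : realType) (u p q : R -> R) (C : R) :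
    (forall x : R, 0 < x -> is_derive x 1 u (- p x)) ->
    (forall x : R, 0 < x -> is_derive x 1 p (- q x)) ->
    (forall x : R, 0 < x -> 0 <= q x) ->
    (forall x y : R, 0 < x -> x <= y -> q y <= q x) ->
    0 <= C ->
    (forall x : R, 0 < x -> x <= 1 -> q (x / 2) <= C * q x) ->
  forall B x y : R, 0 < x -> x <= 1 -> 0 < y -> 16 * B < q x * x ^+ 2 ->
    u y - u x + p x * (y - x) <= B ->
    u x - u y + p y * (x - y) <= (4 + 4 * C) * B.
Proof.
move=> du dp q0 qdecr C0 qdbl B x y x0 x1 y0 qx.
have slp := decreasing_slope dp qdecr.
have pdecr a b : 0 < a -> a <= b -> p b <= p a.
  move=> a0 ab; have /andP[+ _] := slp _ _ a0 ab; rewrite -[p b <= _]subr_ge0.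
  by apply: le_trans; rewrite mulr_ge0 ?subr_ge0 ?q0// (lt_le_trans a0).
have slu := decreasing_slope du pdecr.
have [xy|yx] := leP x y.
  (* Here convexity of p suffices: half of the drop of p from x to y already
     occurs before the midpoint. *)
  pose z := (x + y) / 2.
  have xz : x <= z by rewrite /z; lra.
  have zy : z <= y by rewrite /z; lra.
  have z0 := lt_le_trans x0 xz.
  have /andP[_ u1] := slu _ _ x0 xz; have /andP[_ u2] := slu _ _ z0 zy.
  have /andP[u1' u1''] := slu _ _ x0 xz; have /andP[u2' u2''] := slu _ _ z0 zy.
  have /andP[p1 _] := slp _ _ x0 xz; have /andP[_ p2] := slp _ _ z0 zy.
  have pxz := pdecr _ _ x0 xz; have pzy := pdecr _ _ z0 zy.
  have zxE : z - x = (y - x) / 2 by rewrite /z; lra.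
  have yzE : y - z = (y - x) / 2 by rewrite /z; lra.
  rewrite !(zxE, yzE) in u1 u2 p1 p2.
  have d0 : 0 <= (y - x) / 2 by lra.
  move: d0 u1 u2 p1 p2.
  have : y - x = 2 * ((y - x) / 2) by lra.
  rewrite -[x - y]opprB; move: ((y - x) / 2) => d -> d0 u1 u2 p1 p2 hB.
  have P1 : (p z - p y) * d <= (p x - p z) * d by apply: ler_wpM2r => //; lra.
  have P2 : 0 <= (p x - p z) * d by apply: mulr_ge0 => //; lra.
  have B0 : 0 <= B by lra.
  have := mulr_ge0 C0 B0; lra.
(* For y in [x / 2, x[, doubling gives q y <= C * q x. With d = (x - y) / 2 the hypothesis yields q
   x * d^2 <= B, while the reverse divergence is at most 4 * q y * d^2. *)
have [xy|xy] := leP (x / 2) y.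
  pose z := (x + y) / 2.
  have yz : y <= z by rewrite /z; lra.
  have zx : z <= x by rewrite /z; lra.
  have z0 := lt_le_trans y0 yz.
  have /andP[u1 _] := slu _ _ y0 yz; have /andP[u2 _] := slu _ _ z0 zx.
  have /andP[p1 _] := slp _ _ z0 zx.
  have /andP[_ p2] := slp _ _ y0 (ltW yx).
  have q1 : q y <= C * q x.
    by apply: le_trans (qdbl _ x0 x1); apply: qdecr => //; lra.
  have zxE : x - z = (x - y) / 2 by rewrite /z; lra.
  have yzE : z - y = (x - y) / 2 by rewrite /z; lra.
  rewrite !(zxE, yzE) in u1 u2 p1.
  have d0 : 0 <= (x - y) / 2 by lra.
  move: d0 u1 u2 p1 p2.
  have : x - y = 2 * ((x - y) / 2) by lra.
  rewrite -[y - x]opprB; move: ((x - y) / 2) => d -> d0 u1 u2 p1 p2 hB.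
  have P1 : q x * d * d <= (p z - p x) * d by apply: ler_wpM2r.
  have P2 : q y * (d * d) <= C * q x * (d * d).
    by apply: ler_wpM2r => //; exact: mulr_ge0.
  have P3 : (p y - p x) * d <= q y * (2 * d) * d by apply: ler_wpM2r.
  have Q0 : 0 <= q x * d * d by rewrite !mulr_ge0// q0.
  have D1 : q x * d * d <= B by lra.
  have B0 : 0 <= B := le_trans Q0 D1.
  have := ler_wpM2l C0 D1; have := mulr_ge0 C0 B0; lra.
move=> hB; exfalso.
(* The divergence exceeds its value at x / 2, which is at least q x * x^2 / 16. *)
pose a := x / 2; pose b := x * 3 / 4.
have ya : y <= a by rewrite /a; lra.
have ab : a <= b by rewrite /a /b; lra.
have bx : b <= x by rewrite /b; lra.
have a0 := lt_le_trans y0 ya; have b0 := lt_le_trans a0 ab.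
have /andP[u1 _] := slu _ _ y0 ya; have /andP[u2 _] := slu _ _ a0 ab.
have /andP[u3 _] := slu _ _ b0 bx; have /andP[p1 _] := slp _ _ b0 bx.
have P1 : p x * (a - y) <= p a * (a - y).
  by apply: ler_wpM2r; [lra|apply: pdecr => //; lra].
rewrite (_ : x - b = x / 4) in p1 u3; last by rewrite /b; lra.
rewrite (_ : b - a = x / 4) in u2; last by rewrite /b /a; lra.
have P2 : q x * (x / 4) * (x / 4) <= (p b - p x) * (x / 4).
  by apply: ler_wpM2r => //; lra.
have P3 : p x * (x - y) = p x * (a - y) + p x * (x / 4) + p x * (x / 4).
  by rewrite /a; lra.
lra.
Qed.

Lemma powRN_le (R : realType) (k a b : R) :
  0 <= k -> 0 < a -> a <= b -> b `^ (- k) <= a `^ (- k).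
Proof.
move=> k0 a0 ab; have b0 := lt_le_trans a0 ab.
by rewrite !powRN lef_pV2 ?posrE ?powR_gt0// ge0_ler_powR// nnegrE ltW.
Qed.

(* In the coordinate r = exp(-x) the weight exp(-alpha / (1 - r)^beta) is
   exp(- potential x); potential1 is the opposite of the derivative of the
   potential and potential2 its second derivative. *)
Section ExponentialCoordinates.
Variables (R : realType) (alpha beta : R).
Hypotheses (alpha0 : 0 < alpha) (beta0 : 0 < beta).

Definition gap (x : R) : R := 1 - expR (- x).

Lemma gap_gt0 x : 0 < x -> 0 < gap x.
Proof. by move=> x0; rewrite subr_gt0 expR_lt1 oppr_lt0. Qed.

Lemma gap_le x : gap x <= x.
Proof. by have := expR_ge1Dx (- x); rewrite /gap; lra. Qed.

Lemma gap_homo x y : x <= y -> gap x <= gap y.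
Proof. by move=> xy; rewrite /gap lerD2l lerN2 ler_expR lerN2. Qed.

Lemma gap_half x : 0 < x -> gap x <= 2 * gap (x / 2).
Proof.
move=> x0; have -> : gap x = gap (x / 2) * (1 + expR (- (x / 2))).
  rewrite /gap; have -> : expR (- x) = expR (- (x / 2)) * expR (- (x / 2)).
    by rewrite -expRD; congr expR; lra.
  by ring.
rewrite mulrC ler_wpM2r ?ltW ?gap_gt0 ?divr_gt0//.
suff : expR (- (x / 2)) < 1 by lra.
by rewrite expR_lt1 oppr_lt0 divr_gt0.
Qed.

Lemma gapN_le k x y : 0 <= k -> 0 < x -> x <= y ->
  gap y `^ (- k) <= gap x `^ (- k).
Proof. by move=> k0 x0 xy; rewrite powRN_le ?gap_gt0 ?gap_homo. Qed.

Lemma is_derive_gapN (k x : R) : 0 < x ->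
  is_derive x 1 (fun x => gap x `^ (- k))
    (- (k * gap x `^ (- (k + 1)) * expR (- x))).
Proof.
move=> x0; have g0 := gap_gt0 x0.
have dg : is_derive x 1 gap (expR (- x)).
  by apply: is_derive_eq; rewrite /GRing.scale /=; ring.
have := @is_derive1_comp R (fun y => y `^ (- k)) gap x _ _
  (is_derive1_powR (- k) g0) dg.
by move=> h; apply: is_derive_eq h _; rewrite opprD !mulNr.
Qed.

Definition potential (x : R) : R := alpha * gap x `^ (- beta).

Definition potential1 (x : R) : R :=
  alpha * beta * (gap x `^ (- (beta + 1)) * expR (- x)).

Definition potential2 (x : R) : R :=
  alpha * beta * ((beta + 1) * (gap x `^ (- (beta + 2)) * expR (- (2 * x))) +
                  gap x `^ (- (beta + 1)) * expR (- x)).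

Lemma is_derive_potential (x : R) : 0 < x ->
  is_derive x 1 potential (- potential1 x).
Proof.
move=> x0; have d := is_derive_gapN beta x0.
rewrite /potential.
by apply: is_derive_eq; rewrite /potential1 /GRing.scale/=; ring.
Qed.

Lemma is_derive_potential1 (x : R) : 0 < x ->
  is_derive x 1 potential1 (- potential2 x).
Proof.
move=> x0; have d := is_derive_gapN (beta + 1) x0.
rewrite /potential1.
apply: is_derive_eq; rewrite /potential2 /GRing.scale/=.
have -> : expR (- (2 * x)) = expR (- x) * expR (- x).
  by rewrite -expRD; congr expR; lra.
have -> : beta + 2 = beta + 1 + 1 by lra.
by ring.
Qed.

Lemma potential2_ge0 x : 0 <= potential2 x.
Proof.
rewrite /potential2 !(mulr_ge0, addr_ge0) ?expR_ge0 ?powR_ge0//.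
all: by apply: ltW.
Qed.

Lemma potential2_le x y : 0 < x -> x <= y -> potential2 y <= potential2 x.
Proof.
move=> x0 xy; have [a0 b0] := (ltW alpha0, ltW beta0).
have eN z t : t <= z -> expR (- z) <= expR (- t) by rewrite ler_expR lerN2.
rewrite /potential2; apply: ler_wpM2l; first exact: mulr_ge0.
apply: lerD; last first.
  by apply: ler_pM; rewrite ?powR_ge0 ?expR_ge0 ?eN ?gapN_le ?addr_ge0.
have b1 : 0 <= beta + 1 by lra.
apply: (ler_wpM2l b1).
apply: ler_pM; rewrite ?powR_ge0 ?expR_ge0 ?gapN_le ?addr_ge0//.
by rewrite eN// ler_wpM2l.
Qed.

(** By [gap_half] each negative power of the gap grows by at most 2^(beta + 2), and, since x <= 1,
    each exponential grows by at most e. *)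
Lemma potential2_half x : 0 < x -> x <= 1 ->
  potential2 (x / 2) <= 2 `^ (beta + 2) * expR 1 * potential2 x.
Proof.
move=> x0 x1.
have pow k : 0 <= k -> gap (x / 2) `^ (- k) <= 2 `^ k * gap x `^ (- k).
  move=> k0; have g0 : 0 < gap (x / 2) by rewrite gap_gt0// divr_gt0.
  have := powRN_le k0 (gap_gt0 x0) (gap_half x0).
  by rewrite powRM ?(ltW g0)// [2 `^ _]powRN ler_pdivrMl ?powR_gt0.
have pow1 k : 0 <= k -> k <= beta + 2 ->
    gap (x / 2) `^ (- k) <= 2 `^ (beta + 2) * gap x `^ (- k).
  move=> k0 kb; apply: le_trans (pow _ k0) _.
  by rewrite ler_wpM2r ?powR_ge0// ler_powR// ler1n.
have exp1 y z : z <= y + 1 -> expR z <= expR 1 * expR y.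
  by move=> zy; rewrite -expRD ler_expR addrC.
have mid k y z : 0 <= k -> k <= beta + 2 -> z <= y + 1 ->
    gap (x / 2) `^ (- k) * expR z <=
    2 `^ (beta + 2) * expR 1 * (gap x `^ (- k) * expR y).
  move=> k0 kb zy; rewrite mulrACA.
  by rewrite ler_pM ?powR_ge0 ?expR_ge0// ?pow1 ?exp1.
have [a0 b0] := (ltW alpha0, ltW beta0).
have ab0 : 0 <= alpha * beta by rewrite mulr_ge0.
have b1 : 0 <= beta + 1 by lra.
rewrite /potential2 [leRHS]mulrCA; apply: (ler_wpM2l ab0).
rewrite mulrDr; apply: lerD; last by apply: mid; lra.
by rewrite [leRHS]mulrCA; apply: (ler_wpM2l b1); apply: mid; lra.
Qed.

(** Since gap x <= x, the first summand of [potential2] alone gives a lower bound K * x^(-beta) for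
    the product when x <= 1. The threshold is where this reaches |M| + 1. *)
Lemma potential2_large M : exists x0 : R, [/\ 0 < x0, x0 <= 1 &
  forall x, 0 < x -> x <= x0 -> M < potential2 x * x ^+ 2].
Proof.
pose K := alpha * beta * (beta + 1) * expR (- 2).
have K0 : 0 < K by rewrite !mulr_gt0 ?expR_gt0// addr_gt0.
pose L := (`|M| + 1) / K.
have L0 : 0 < L by rewrite divr_gt0// ltr_wpDl.
exists (Num.min 1 (L `^ (- beta^-1))); split; first by rewrite lt_min ltr01 powR_gt0.
  by rewrite ge_min lexx.
move=> x x0; rewrite le_min => /andP[x1 xL].
have Lx : L <= x `^ (- beta).
  apply: le_trans (powRN_le (ltW beta0) x0 xL).
  by rewrite -powRrM mulrNN mulVf ?gt_eqF// powRr1// ltW.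
have : `|M| + 1 <= K * x `^ (- beta).
  by rewrite -ler_pdivrMl// mulrC.
have -> : x `^ (- beta) = x `^ (- (beta + 2)) * x ^+ 2.
  rewrite -powR_mulrn ?ltW// -powRD; last by rewrite (gt_eqF x0) implybT.
  by congr powR; lra.
move=> h; apply: (@lt_le_trans _ _ (`|M| + 1)).
  by have := ler_norm M; lra.
apply: (le_trans h); rewrite mulrA; apply: ler_wpM2r; first exact: sqr_ge0.
have ab0 : 0 <= alpha * beta by rewrite mulr_ge0 ?ltW.
have b1 : 0 <= beta + 1 by rewrite addr_ge0 ?ltW.
rewrite /potential2 /K -mulrA -mulrA; apply: (ler_wpM2l ab0).
apply: ler_wpDr; first by rewrite mulr_ge0 ?powR_ge0 ?expR_ge0.
apply: (ler_wpM2l b1); rewrite mulrC.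
apply: ler_pM; rewrite ?powR_ge0 ?expR_ge0//.
  by rewrite powRN_le ?gap_gt0 ?gap_le// addr_ge0 ?ltW.
by rewrite ler_expR; lra.
Qed.

End ExponentialCoordinates.

(** The maximized function vanishes at 0 and at 1 but is positive at 1/2. *)
Lemma max_points_gt0_lt1 (R : realType) (v : R[i]^o -> R) (r_ : R -> R) (m : R) :
  is_weight v -> max_points v r_ -> 0 < m -> 0 < r_ m < 1.
Proof.
move=> hv hr m0; have [/andP[r0 r1] rmax] := hr _ m0.
have : 0 < r_ m `^ m * profile v (r_ m).
  apply: (@lt_le_trans _ _ (2^-1 `^ m * profile v 2^-1)).
    by rewrite mulr_gt0 ?powR_gt0 ?invr_gt0// profile_gt0//; lra.
  by apply: rmax; lra.
move=> pos; apply/andP; split; rewrite lt_neqAle ?r0 ?r1 andbT.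
  by apply: contraTneq pos => <-; rewrite powR0 ?mul0r ?ltxx// gt_eqF.
by apply: contraTneq pos => ->; rewrite /profile ltxx mulr0 ltxx.
Qed.

(** * Condition (B) for exponential weights *)

Lemma exponential_condition_B (R : realType) (v : R[i]^o -> R)
    (alpha beta : R) :
  is_weight v -> 0 < alpha -> 0 < beta -> is_exponential alpha beta v ->
  condition_B v.
Proof.
move=> hv a0 b0 hexp r_ hr b1 hb1.
pose C := 2 `^ (beta + 2) * expR 1.
have C0 : 0 <= C by rewrite mulr_ge0 ?powR_ge0 ?expR_ge0.
pose u := potential alpha beta; pose p := potential1 alpha beta.
pose q := potential2 alpha beta.
have du (x : R) : 0 < x -> is_derive x 1 u (- p x).
  exact: is_derive_potential.
have dp (x : R) : 0 < x -> is_derive x 1 p (- q x).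
  exact: is_derive_potential1.
have p_ge0 x : 0 <= p x by rewrite !mulr_ge0 ?powR_ge0 ?expR_ge0 ?ltW.
have q_ge0 x : 0 <= q x by exact: potential2_ge0.
have q_le (x y : R) : 0 < x -> x <= y -> q y <= q x.
  exact: potential2_le.
have q_half (x : R) : 0 < x -> x <= 1 -> q (x / 2) <= C * q x.
  exact: potential2_half.
have q_large : exists z : R, [/\ 0 < z, z <= 1 & forall x, 0 < x -> x <= z ->
    16 * ln b1 < q x * x ^+ 2] by exact: potential2_large.
have profE x : 0 < x -> profile v (expR (- x)) = expR (- u x).
  move=> hx; rewrite /profile expR_lt1 oppr_lt0 hx hexp.
    by rewrite /u /potential /gap powRN.
  by rewrite expR_ge0 expR_lt1 oppr_lt0 hx.
clearbody C u p q.
pose x_ (m : R) := - ln (r_ m).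
have rE m : 0 < m -> r_ m = expR (- x_ m).
  move=> m0; have /andP[r0 _] := max_points_gt0_lt1 hv hr m0.
  by rewrite opprK lnK// posrE.
have x0 m : 0 < m -> 0 < x_ m.
  move=> m0; have /andP[_] := max_points_gt0_lt1 hv hr m0.
  by rewrite rE// expR_lt1 oppr_lt0.
have min_x m y : 0 < m -> 0 < y -> m * x_ m + u (x_ m) <= m * y + u y.
  move=> m0 y0; have [_ /(_ (expR (- y)))] := hr _ m0.
  have -> : 0 <= expR (- y) <= 1 by rewrite expR_ge0 expR_le1 oppr_le0 ltW.
  move=> /(_ isT); rewrite (rE m m0) profE// profE ?x0//.
  by rewrite -!expRM -!expRD ler_expR; lra.
(* [x_ m] is an interior minimum of t |-> m * t + u t on the positive half-line, so the derivative m
   - p vanishes there. *)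
have crit m : 0 < m -> p (x_ m) = m.
  move=> m0; have xm0 := x0 _ m0.
  have dF (t : R) : 0 < t -> is_derive t 1 (fun t => m * t + u t) (m - p t).
    move=> t0; have := du _ t0 => dut.
    by apply: is_derive_eq; rewrite /GRing.scale /=; ring.
  have [|t||t|_ F0] := @derive1_at_min _ (fun t => m * t + u t)
      (x_ m / 2) (x_ m * 2) (x_ m).
  - by lra.
  - rewrite in_itv /= => /andP[t0 _].
    by have [] := dF t; first by apply: lt_trans t0; rewrite divr_gt0.
  - by rewrite in_itv /=; lra.
  - rewrite in_itv /= => /andP[t0 _]; apply: min_x => //.
    by apply: lt_trans t0; rewrite divr_gt0.
  by have [_ F1] := dF _ xm0; move: F0; rewrite F1; lra.
have ratioE m n : 0 < m -> 0 < n ->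
    (r_ m / r_ n) `^ m * (profile v (r_ m) / profile v (r_ n)) =
    expR (u (x_ n) - u (x_ m) + p (x_ m) * (x_ n - x_ m)).
  move=> m0 n0; rewrite crit// !rE// !profE ?x0// -!expRN -!expRD -expRM -expRD.
  by congr expR; ring.
have [z [z0 z1 hz]] := q_large.
(* The exponential is the bound of [bregman_swap] for B = ln b1; adding 1 makes it exceed 1. As [p]
   is nonincreasing, m > p z forces x_m <= z, the range where q x * x^2 > 16 * ln b1. *)
exists (1 + expR ((4 + 4 * C) * ln b1)), (p z + 1); split.
- by rewrite ltrDl expR_gt0.
- by rewrite ltr_wpDl.
move=> m n m0 n0; rewrite !ratioE// => hB cm cn _.
have xmz : x_ m <= z.
  rewrite leNgt; apply/negP => zx.
  have /andP[+ _] := decreasing_slope dp q_le z0 (ltW zx).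
  have : 0 <= q (x_ m) * (x_ m - z) by rewrite mulr_ge0// subr_ge0 ltW.
  by rewrite (crit m m0); lra.
apply: ler_wpDl => //; rewrite ler_expR.
apply: (bregman_swap du dp (fun x _ => q_ge0 x) q_le C0 q_half).
- exact: x0.
- exact: le_trans z1.
- exact: x0.
- by apply: hz => //; exact: x0.
- by rewrite -ler_expR lnK// posrE; lra.
Qed.

(** * Normal weights *)

Lemma pow2_bracket (R : realType) (x : R) :
  1 <= x -> exists j : nat, 2 ^+ j <= x < 2 ^+ j.+1.
Proof.
move=> x1; have x0 : 0 <= x by apply: le_trans x1.
have /andP[tx xt] := truncn_itv x0.
have t0 : (0 < Num.truncn x)%N by rewrite truncn_gt0.
have /= /andP[b1 b2] := trunc_log_bounds (ltnSn 1) t0.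
exists (trunc_log 2 (Num.truncn x)); rewrite -!natrX.
rewrite (le_trans _ tx) ?ler_nat//=.
by rewrite (lt_le_trans xt)// ler_nat.
Qed.

Lemma dyadic_bracket (R : realType) (s : R) :
  0 < s -> s <= 1 -> exists n : nat, 2 ^- n.+1 < s <= 2 ^- n.
Proof.
move=> s0 s1; have [|n /andP[n1 n2]] := @pow2_bracket _ s^-1.
  by rewrite invf_ge1.
exists n; rewrite -[X in _ < X]invrK -[X in X <= _]invrK.
by rewrite ltf_pV2 ?lef_pV2 ?posrE ?invr_gt0 ?exprn_gt0// n1 n2.
Qed.

Lemma ereal_sup_lty (R : realType) (S : set (\bar R)) :
  (ereal_sup S < +oo)%E -> exists M : R, forall y, S y -> (y <= M%:E)%E.
Proof.
case E : (ereal_sup S) => [r| |]// _.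
  by exists r => y Sy; rewrite -E; exact: ereal_sup_ubound.
exists 0 => y Sy; apply: (@le_trans _ _ -oo%E); last exact: leNye.
by rewrite -E; exact: ereal_sup_ubound.
Qed.

(** This and [decaying] are the two dyadic conditions of normality for a continuous parameter [s],
    the distance to the circle. *)
Definition doubling (R : realType) (w : R -> R) (C : R) : Prop :=
  forall s, 0 < s -> s <= 1 -> w (1 - s) <= C * w (1 - s / 2).

Definition decaying (R : realType) (w : R -> R) (q K s0 : R) : Prop :=
  forall s, 0 < s -> s <= s0 -> w (1 - s / K) <= q * w (1 - s).

Lemma profile_dyadic (R : realType) (v : R[i]^o -> R) n :
  v (1 - 2 ^- n)%:C = profile v (1 - 2 ^- n).
Proof. by rewrite /profile gtrDl oppr_lt0 invr_gt0 exprn_gt0. Qed.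

Lemma dyadic_le1 (R : realType) n : (2 : R) ^- n <= 1.
Proof. by rewrite invf_le1 ?exprn_gt0// exprn_ege1// ler1n. Qed.

Lemma profile_dyadic_gt0 (R : realType) (v : R[i]^o -> R) n :
  is_weight v -> 0 < profile v (1 - 2 ^- n).
Proof.
by move=> hv; apply: profile_gt0; rewrite ?subr_ge0 ?dyadic_le1.
Qed.

Lemma normal_doubling (R : realType) (v : R[i]^o -> R) :
  is_weight v -> is_normal v -> exists2 C, 1 <= C & doubling (profile v) C.
Proof.
move=> hv [/ereal_sup_lty[M hM] _].
pose w n := profile v (1 - 2 ^- n).
have w0 n : 0 < w n by exact: profile_dyadic_gt0.
pose M1 := Num.max 1 M.
have M1_ge1 : 1 <= M1 by rewrite le_max lexx.
have hM1 n : w n <= M1 * w n.+1.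
  rewrite -ler_pdivrMr//; apply: (@le_trans _ _ M); last first.
    by rewrite le_max lexx orbT.
  by rewrite -lee_fin; apply: hM; exists n => //; rewrite !profile_dyadic.
(* If 2^-(n+1) < s <= 2^-n, then s / 2 > 2^-(n+2), so halving s costs at most two dyadic steps. *)
exists (M1 * M1); first by rewrite mulr_ege1.
move=> s s0 s1; have [n /andP[ns sn]] := dyadic_bracket s0 s1.
apply: (@le_trans _ _ (w n)).
  by apply: profile_le => //; rewrite ?lerD2l ?lerN2// subr_ge0 dyadic_le1.
apply: (le_trans (hM1 n)); rewrite -mulrA ler_wpM2l ?(le_trans _ M1_ge1)//.
apply: (le_trans (hM1 n.+1)); rewrite ler_wpM2l ?(le_trans _ M1_ge1)//.
apply: profile_le => //; first by lra.
rewrite lerD2l lerN2 [2 ^+ n.+2]exprSr invfM ler_wpM2r//.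
exact: ltW.
Qed.

Lemma normal_decaying (R : realType) (v : R[i]^o -> R) :
  is_weight v -> is_normal v -> exists q K s0,
  [/\ 0 < q < 1, 1 <= K, 0 < s0 & decaying (profile v) q K s0].
Proof.
move=> hv [_ /ereal_inf_lt[_ [k _ <-]]].
pose w n := profile v (1 - 2 ^- n).
have w0 n : 0 < w n by exact: profile_dyadic_gt0.
under eq_fun do rewrite !profile_dyadic.
rewrite -/(w _); set a := (fun n => _).
(* The limsup is the infimum of the tail suprema, so one of these is below 1. It is a positive real
   because the ratios are, and it serves as q. *)
rewrite limn_esup_lim (cvg_lim _ (@cvg_esups_inf _ a))//.
move=> /ereal_inf_lt[_ [N _ <-]] aN1.
have [q q01 hq] : exists2 q, 0 < q < 1 &
    forall n, (N <= n)%N -> w (n + k)%N <= q * w n.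
  have le_sup n : (N <= n)%N -> (a n <= esups a N)%E.
    by move=> Nn; apply: ereal_sup_ubound; exists n.
  case: (esups a N) aN1 le_sup => [q| |]//.
    rewrite lte_fin => q1 hq; exists q.
      rewrite q1 andbT; have := hq _ (leqnn N); rewrite lee_fin.
      by apply: lt_le_trans; apply: divr_gt0; exact: w0.
    by move=> n Nn; rewrite -ler_pdivrMr// -lee_fin; exact: hq.
  by move=> _ /(_ _ (leqnn N)).
(* The extra factor 2 in K pays for rounding s to a dyadic point; s <= 2^-N puts that point in the
   tail where the ratio bound holds. *)
exists q, (2 ^+ k.+1), (2 ^- N); split; rewrite ?dyadic_le1 ?invr_gt0//.
  by rewrite exprn_ege1// ler1n.
move=> s s0 sN.
have [n /andP[ns sn]] := dyadic_bracket s0 (le_trans sN (dyadic_le1 _ N)).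
have Nn : (N <= n.+1)%N.
  have := lt_le_trans ns sN; rewrite ltf_pV2 ?posrE ?exprn_gt0//.
  by rewrite ltr_eXn2l ?ltr1n// => /ltnW.
have s1 := le_trans sn (dyadic_le1 _ n).
apply: (@le_trans _ _ (w (n.+1 + k)%N)).
  apply: profile_le => //; first by rewrite subr_ge0 dyadic_le1.
  by rewrite lerD2l lerN2 addSnnS exprD invfM ler_wpM2r.
apply: (le_trans (hq _ Nn)).
have /andP[q0 _] := q01.
apply: (ler_wpM2l (ltW q0)).
by apply: profile_le => //; [lra|rewrite lerD2l lerN2 ltW].
Qed.

(** * Iterated doubling and decay of a nonincreasing profile *)

Section DoublingDecay.
Variables (R : realType) (w : R -> R).
Hypothesis w_gt0 : forall r, 0 <= r -> r < 1 -> 0 < w r.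
Hypothesis w_le : forall r s, 0 <= r -> r <= s -> w s <= w r.

Let w1_gt0 s : 0 < s -> s <= 1 -> 0 < w (1 - s).
Proof. by move=> s0 s1; apply: w_gt0; lra. Qed.

Lemma doubling_iter C j s : 0 <= C -> doubling w C -> 0 < s -> s <= 1 ->
  w (1 - s) <= C ^+ j * w (1 - s / 2 ^+ j).
Proof.
move=> C0 dblw s0 s1; elim: j => [|j IH]; first by rewrite !expr0 mul1r divr1.
apply: (le_trans IH); rewrite exprSr -mulrA ler_wpM2l ?exprn_ge0//.
rewrite exprSr invfM mulrA; apply: dblw; first by rewrite divr_gt0// exprn_gt0.
by rewrite ler_pdivrMr ?exprn_gt0// mul1r (le_trans s1)// exprn_ege1// ler1n.
Qed.

Lemma decaying_iter q K s0 j s : 0 <= q -> 1 <= K -> decaying w q K s0 ->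
  0 < s -> s <= s0 -> w (1 - s / K ^+ j) <= q ^+ j * w (1 - s).
Proof.
move=> q0 K1 decw sp ss0; have K0 := lt_le_trans ltr01 K1.
elim: j => [|j IH]; first by rewrite !expr0 mul1r divr1.
rewrite [q ^+ _]exprS -mulrA; apply: (le_trans _ (ler_wpM2l q0 IH)).
rewrite [K ^+ _]exprSr invfM mulrA; apply: decw; first by rewrite divr_gt0// exprn_gt0.
by rewrite (le_trans _ ss0)// ler_pdivrMr ?exprn_gt0// ler_peMr ?(ltW sp)// exprn_ege1.
Qed.

(* Iterating the doubling gives w (1 - t) <= C^(j+1) w (1 - 1/m) when
   2^j <= m t < 2^(j+1), which exp(- m t) beats for j large. *)
Lemma doubling_near_bound C kappa : 1 <= C -> doubling w C -> 0 < kappa ->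
  exists2 C2 : R, 0 < C2 & forall m t, 1 <= m -> 0 < t -> t <= 1 ->
    kappa * w (1 - m^-1) <= expR (- (m * t)) * w (1 - t) -> m * t <= C2.
Proof.
move=> C1 dblw k0; have C0 := lt_le_trans ltr01 C1.
pose L := ln C; pose B := `|ln kappa|.
pose J := Num.truncn (4 * (L + B + 1)).
exists (2 ^+ J); first by rewrite exprn_gt0.
move=> m t m1 t0 t1 h; rewrite leNgt; apply/negP => Jmt.
have m0 := lt_le_trans ltr01 m1.
have [|j /andP[j1 j2]] := @pow2_bracket _ (m * t).
  by apply: le_trans (ltW Jmt); rewrite exprn_ege1// ler1n.
have Jj : (J <= j)%N.
  by have := lt_trans Jmt j2; rewrite ltr_eXn2l ?ltr1n.
have : kappa <= expR (- (2 ^+ j)) * C ^+ j.+1.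
  have wm : 0 < w (1 - m^-1) by rewrite w1_gt0 ?invr_gt0// invf_le1.
  rewrite -(ler_pM2r wm); apply: (le_trans h); rewrite -mulrA.
  apply: ler_pM; rewrite ?expR_ge0 ?ler_expR ?lerN2//; first by rewrite ltW ?w1_gt0.
  apply: (le_trans (doubling_iter j.+1 (ltW C0) dblw t0 t1)).
  rewrite ler_wpM2l ?exprn_ge0 ?(ltW C0)//; apply: w_le.
    by rewrite subr_ge0 invf_le1.
  rewrite lerD2l lerN2 ler_pdivrMr ?exprn_gt0//.
  by rewrite ler_pdivlMl// ltW.
(* Logarithms give 2^j <= (j + 1) * L + B. But y = j + 1 exceeds 4 * (L + B + 1) by the choice of J,
   and y^2 <= 4 * 2^j then gives 2^j > y * (L + B + 1), a contradiction. *)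
rewrite -ler_ln ?posrE ?mulr_gt0 ?exprn_gt0 ?expR_gt0//.
rewrite lnM ?posrE ?exprn_gt0 ?expR_gt0// expRK lnXn// -/L -[_ *+ j.+1]mulr_natl.
have : 0 <= L by rewrite ln_ge0.
have : - ln kappa <= B by rewrite /B -normrN ler_norm.
have : 0 <= B by exact: normr_ge0.
have : 4 * (L + B + 1) < j.+1%:R.
  by apply: lt_le_trans (truncnS_gt _) _; rewrite ler_nat.
have : (j.+1%:R : R) ^+ 2 <= 4 * 2 ^+ j.
  rewrite -!natrX -natrM ler_nat.
  elim: j {j1 j2 Jj} => [|[|[|i]] IH]//.
  by rewrite [(2 ^ _)%N]expnS; nia.
have : 1 <= (j.+1%:R : R) by rewrite ler1n.
clearbody L B; move: (2 ^+ j) (j.+1%:R : R) => P y y1 yP yL B0 BL L0 H.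
have y0 : 0 < y by lra.
have := mulr_gt0 y0 (_ : 0 < y - 4 * (L + B + 1)).
rewrite subr_gt0 => /(_ yL).
have := mulr_ge0 B0 (_ : 0 <= y - 1).
rewrite subr_ge0 => /(_ y1).
lra.
Qed.

(** If m * t < K^-j, then j decay steps starting from 1/m give w (1 - t) <= q^j * w (1 - 1/m), which
    is too small once q^j < kappa. *)
Lemma decaying_near_bound q K s0 kappa : 0 < q -> q < 1 -> 1 <= K ->
  decaying w q K s0 -> 0 < kappa ->
  exists2 c : R, 0 < c & forall m t, 1 <= m -> m^-1 <= s0 -> 0 < t -> t <= 1 ->
    kappa * w (1 - m^-1) <= w (1 - t) -> c <= m * t.
Proof.
move=> q0 q1 K1 decw k0; have K0 := lt_le_trans ltr01 K1.
have [j qj] : exists j, q ^+ j < kappa.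
  have lq : 0 < - ln q by rewrite oppr_gt0 ln_lt0// q0 q1.
  exists (Num.truncn (`|ln kappa| / - ln q)).+1.
  rewrite -ltr_ln ?posrE ?exprn_gt0// lnXn// -mulr_natl.
  have := truncnS_gt (`|ln kappa| / - ln q).
  rewrite ltr_pdivrMr// => h.
  have : - ln kappa <= `|ln kappa| by rewrite -normrN ler_norm.
  by lra.
exists (K ^- j); first by rewrite invr_gt0 exprn_gt0.
move=> m t m1 ms t0 t1 h; rewrite leNgt; apply/negP => mt.
have m0 := lt_le_trans ltr01 m1.
have wm : 0 < w (1 - m^-1) by rewrite w1_gt0 ?invr_gt0// invf_le1.
have : w (1 - t) <= q ^+ j * w (1 - m^-1).
  apply: le_trans (decaying_iter j (ltW q0) K1 decw _ ms); last first.
    by rewrite invr_gt0.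
  apply: w_le.
    rewrite subr_ge0 ler_pdivrMr ?exprn_gt0// mul1r.
    by rewrite (@le_trans _ _ 1) ?invf_le1// exprn_ege1.
  by rewrite lerD2l lerN2 ler_pdivlMl// ltW.
move=> /(le_trans h); rewrite ler_pM2r// => /le_lt_trans /(_ qj).
by rewrite ltxx.
Qed.

End DoublingDecay.

(** * Condition (B) for normal weights *)

Lemma powR_expR_bounds (R : realType) (t m : R) : 0 <= m -> 0 <= t -> 2 * t <= 1 ->
  expR (- (2 * (m * t))) <= (1 - t) `^ m.
Proof.
move=> m0 t0 t1.
have -> : - (2 * (m * t)) = - (2 * t) * m by ring.
rewrite expRM; apply: ge0_ler_powR; rewrite ?nnegrE ?expR_ge0//; first by lra.
rewrite expRN -[leRHS]invrK lef_pV2 ?posrE ?invr_gt0 ?expR_gt0//; last by lra.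
rewrite -div1r ler_pdivrMr; last by lra.
(* For t <= 1/2, 1 <= (1 + 2t)(1 - t) <= e^(2t) (1 - t). *)
apply: (@le_trans _ _ ((1 + 2 * t) * (1 - t))); first by nra.
by rewrite ler_wpM2r ?expR_ge1Dx//; lra.
Qed.

Lemma powR_le_expR (R : realType) (t m : R) : 0 <= m -> 0 <= t -> t <= 1 ->
  (1 - t) `^ m <= expR (- (m * t)).
Proof.
move=> m0 t0 t1; have -> : - (m * t) = - t * m by ring.
rewrite expRM; apply: ge0_ler_powR; rewrite ?nnegrE ?expR_ge0//; first by lra.
exact: expR_ge1Dx.
Qed.

Lemma normal_condition_B (R : realType) (v : R[i]^o -> R) :
  is_weight v -> is_normal v -> condition_B v.
Proof.
move=> hv hn r_ hr b1 hb1.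
have [C C1 dblw] := normal_doubling hv hn.
have [q [K [s0 [/andP[q0 q1] K1 s00 decw]]]] := normal_decaying hv hn.
pose w := profile v; rewrite -/w.
have w_gt0 r : 0 <= r -> r < 1 -> 0 < w r by exact: profile_gt0.
have w_le r s : 0 <= r -> r <= s -> w s <= w r by exact: profile_le.
rewrite -/w in dblw decw.
have hmax m s : 0 < m -> 0 <= s -> s <= 1 ->
    s `^ m * w s <= r_ m `^ m * w (r_ m).
  by move=> m0 s0' s1; have [_] := hr _ m0; apply; rewrite s0' s1.
pose t_ (m : R) := 1 - r_ m.
have tP m : 0 < m -> 0 < t_ m < 1.
  by move=> m0; have := max_points_gt0_lt1 hv hr m0; rewrite /t_; lra.
have rE m : r_ m = 1 - t_ m by rewrite /t_; ring.
clearbody w t_.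
have wt_gt0 t : 0 < t -> t <= 1 -> 0 < w (1 - t).
  by move=> t0 t1; apply: w_gt0; lra.
(* The maximum is compared with the value at 1 - 1/m, where (1 - 1/m)^m >= e^-2. *)
have low m : 2 <= m -> expR (- 2) * w (1 - m^-1) <= r_ m `^ m * w (r_ m).
  move=> m2; have m0 : 0 < m by lra.
  have mi : m^-1 <= 2^-1 by rewrite lef_pV2 ?posrE.
  have mi0 : 0 < m^-1 by rewrite invr_gt0.
  apply: (le_trans _ (hmax m (1 - m^-1) m0 _ _)); try lra.
  apply: ler_wpM2r; first by apply/ltW/wt_gt0; lra.
  have -> : - (2 : R) = - (2 * (m * m^-1)) by rewrite divff ?mulr1// gt_eqF.
  by apply: powR_expR_bounds; lra.
have near kappa : 0 < kappa -> exists c C2 : R, [/\ 0 < c, 0 < C2 &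
    forall m t, 2 <= m -> m^-1 <= s0 -> 0 < t -> t <= 1 ->
    kappa * w (1 - m^-1) <= (1 - t) `^ m * w (1 - t) -> c <= m * t <= C2].
  move=> k0.
  have [c c0 hc] := decaying_near_bound w_gt0 w_le q0 q1 K1 decw k0.
  have [C2 C20 hC] := doubling_near_bound w_gt0 w_le C1 dblw k0.
  exists c, C2; split=> // m t m2 ms t0 t1 h.
  have m1 : 1 <= m by lra.
  have wt : 0 <= w (1 - t) by rewrite ltW ?wt_gt0.
  have m0 : 0 <= m by apply: le_trans m1.
  have pe : (1 - t) `^ m <= expR (- (m * t)) by rewrite powR_le_expR// ltW.
  have h' : kappa * w (1 - m^-1) <= expR (- (m * t)) * w (1 - t).
    by apply: (le_trans h); apply: ler_wpM2r.
  apply/andP; split; last by apply: hC.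
  apply: hc => //; apply: (le_trans h'); rewrite -[leRHS]mul1r.
  by apply: ler_wpM2r => //; rewrite expR_le1 oppr_le0 mulr_ge0// ltW.
(* The constant e^-2 handles m * t_m and n * t_n; the smaller e^-2 / b1 handles the mixed product m
   * t_n, where the hypothesis of (B) loses a factor b1. *)
have [c0 [T [c00 T0 near0]]] := near _ (expR_gt0 (- 2)).
have [|c1 [T1 [c10 T10 near1]]] := near (expR (- 2) / b1).
  by rewrite divr_gt0 ?expR_gt0; lra.
(* J halvings bring t_n below t_m: m * t_n <= T1 <= c0 * 2^J <= 2^J * m * t_m. *)
have [J TJ] : exists J : nat, T1 <= c0 * 2 ^+ J.
  exists (Num.truncn (T1 / c0)).+1; rewrite -ler_pdivrMl// mulrC.
  apply: (le_trans (ltW (truncnS_gt _))).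
  by rewrite -natrX ler_nat ltnW// ltn_expl.
have b10 : 0 < b1 by lra.
(* C^J bounds w(r_n) / w(r_m), and the exponential bounds r_m^(-n), because n * t_m <= T^2 / c1. In
   the threshold, 2 and 1/s0 give access to [near], and 2 * T ensures t_m <= 1/2. *)
exists (1 + expR (2 * (T * T / c1)) * C ^+ J), (2 + s0^-1 + 2 * T).
have C0 : 0 <= C by lra.
have si0 : 0 < s0^-1 by rewrite invr_gt0.
split; [|lra|].
  by rewrite ltrDl mulr_gt0 ?expR_gt0// exprn_gt0; lra.
move=> m n m0 n0 hA cm cn _.
have /andP[tm0 tm1] := tP _ m0; have /andP[tn0 tn1] := tP _ n0.
have large k : 2 + s0^-1 + 2 * T <= k -> [/\ 2 <= k, s0^-1 <= k & 2 * T <= k].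
  by clear -si0 T0 => ?; split; lra.
have [m2 mi mT] := large _ cm.
have [n2 ni nT] := large _ cn.
have ms : m^-1 <= s0 by rewrite -[s0]invrK lef_pV2 ?posrE.
have ns : n^-1 <= s0 by rewrite -[s0]invrK lef_pV2 ?posrE.
have [rm0 rm1] : 0 < r_ m /\ r_ m <= 1.
  by rewrite rE subr_gt0 gerBl tm1 ltW.
have [rn0 rn1] : 0 < r_ n /\ r_ n <= 1.
  by rewrite rE subr_gt0 gerBl tn1 ltW.
have ratioE a b k x y : 0 < a -> 0 < b ->
    (a / b) `^ k * (x / y) = (a `^ k * x) / (b `^ k * y).
  move=> a0 b0; have -> : a `^ k = (a / b) `^ k * b `^ k.
    by rewrite -powRM ?divr_ge0 ?divfK ?gt_eqF// ltW.
  have bk : b `^ k != 0 by rewrite gt_eqF// powR_gt0.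
  by rewrite invfM mulrACA mulfK// mulrA.
have wm0 : 0 < w (r_ m) by rewrite rE wt_gt0// ltW.
have wn0 : 0 < w (r_ n) by rewrite rE wt_gt0// ltW.
move: hA; rewrite !ratioE// ler_pdivrMr ?mulr_gt0 ?powR_gt0// => hA.
rewrite ler_pdivrMr ?mulr_gt0 ?powR_gt0//.
have /andP[am bm] : c0 <= m * t_ m <= T.
  by apply: near0; rewrite -?rE ?low// ltW.
have /andP[an bn] : c0 <= n * t_ n <= T.
  by apply: near0; rewrite -?rE ?low// ltW.
have /andP[amn bmn] : c1 <= m * t_ n <= T1.
  apply: near1; rewrite -?rE ?(ltW tn1)//.
  rewrite [_ / b1]mulrC -mulrA ler_pdivrMl//.
  by apply: le_trans hA; exact: low.
have ntm : n * t_ m <= T * T / c1.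
  rewrite ler_pdivlMr//; apply: (@le_trans _ _ (n * t_ m * (m * t_ n))).
    by apply: ler_wpM2l => //; rewrite mulr_ge0 ?ltW.
  have -> : n * t_ m * (m * t_ n) = (n * t_ n) * (m * t_ m) by ring.
  by apply: ler_pM; rewrite // mulr_ge0// ltW.
have wnm : w (r_ n) <= C ^+ J * w (r_ m).
  rewrite !rE; apply: (le_trans (doubling_iter J C0 dblw tn0 (ltW tn1))).
  apply: ler_wpM2l; first exact: exprn_ge0.
  apply: w_le; first by rewrite subr_ge0 ltW.
  rewrite lerD2l lerN2 ler_pdivrMr ?exprn_gt0// -(ler_pM2l m0).
  apply: (le_trans bmn); apply: (le_trans TJ).
  by rewrite mulrA; apply: ler_wpM2r => //; exact: exprn_ge0.
have tm_half : 2 * t_ m <= 1.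
  by rewrite -(ler_pM2l m0) mulr1 mulrCA (le_trans _ mT)// ler_pM2l.
have rnn : r_ n `^ n <= 1.
  have := ge0_ler_powR (ltW n0) _ _ rn1; rewrite powR1.
  by apply; rewrite nnegrE// ltW.
have rmn : 1 <= expR (2 * (T * T / c1)) * r_ m `^ n.
  rewrite -ler_pdivrMl ?expR_gt0// mulr1 -expRN rE.
  apply: le_trans (powR_expR_bounds (ltW n0) (ltW tm0) tm_half).
  by rewrite ler_expR lerN2 ler_pM2l.
apply: (@le_trans _ _ (1 * (C ^+ J * w (r_ m)))).
  by apply: ler_pM => //; rewrite ?powR_ge0// ltW.
apply: (@le_trans _ _ ((expR (2 * (T * T / c1)) * r_ m `^ n) *
    (C ^+ J * w (r_ m)))).
  by apply: ler_wpM2r => //; rewrite mulr_ge0 ?exprn_ge0// ltW.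
rewrite mulrACA; apply: ler_wpM2r; last by rewrite lerDr.
by rewrite mulr_ge0 ?powR_ge0// ltW.
Qed.

(** * Moments *)

(** The feature common to normal and exponential weights from which the moment condition is
    derived. *)
Definition exp_minorized (R : realType) (w : R -> R) (alpha beta c : R) : Prop :=
  forall t, 0 < t -> t <= 1 -> c * expR (- (alpha * t `^ (- beta))) <= w (1 - t).

(** For t of order 2^-j, doubling from the origin gives v(1 - t) >= C^-(j+1) v(0), and j + 1 <= 2^j
    <= 1/t. The 1 in alpha = 1 + ln C keeps alpha positive when C = 1. *)
Lemma normal_exp_minorized (R : realType) (v : R[i]^o -> R) :
  is_weight v -> is_normal v -> exists alpha c : R,
  [/\ 0 < alpha, 0 < c & exp_minorized (profile v) alpha 1 c].
Proof.
move=> hv hn; have [C C1 dblw] := normal_doubling hv hn.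
have C0 : 0 < C by apply: lt_le_trans C1.
have w0 : 0 < profile v 0 by apply: profile_gt0.
exists (1 + ln C), (profile v 0); split=> //.
  by rewrite ltr_pwDl// ln_ge0.
move=> t t0 t1; have [j /andP[j1 j2]] := dyadic_bracket t0 t1.
have := doubling_iter j.+1 (ltW C0) dblw ltr01 (lexx 1).
rewrite subrr div1r => h.
have {}h : profile v 0 <= C ^+ j.+1 * profile v (1 - t).
  apply: (le_trans h); rewrite ler_wpM2l ?exprn_ge0 ?(ltW C0)//.
  apply: profile_le => //; first by rewrite subr_ge0.
  by rewrite lerD2l lerN2 ltW.
rewrite powR_inv1 ?(ltW t0)//.
have small : C ^+ j.+1 * expR (- ((1 + ln C) * t^-1)) <= 1.
  rewrite -[C in C ^+ _](@lnK _ C) ?posrE// -expRM_natl -expRD expR_le1.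
  rewrite subr_le0 mulrC; apply: ler_pM => //; first exact: ln_ge0.
    by rewrite lerDr.
  apply: (@le_trans _ _ (2 ^+ j)); first by rewrite -natrX ler_nat ltn_expl.
  by rewrite -[2 ^+ j]invrK lef_pV2 ?posrE ?invr_gt0 ?exprn_gt0.
apply: le_trans (ler_wpM2r (expR_ge0 _) h) _.
rewrite mulrAC -[leRHS]mul1r; apply: ler_wpM2r small.
by apply: profile_ge0 => //; rewrite subr_ge0.
Qed.

Lemma exponential_exp_minorized (R : realType) (v : R[i]^o -> R)
    (alpha beta : R) : is_exponential alpha beta v ->
  exp_minorized (profile v) alpha beta 1.
Proof.
move=> hexp t t0 t1; rewrite /profile gtrDl oppr_lt0 t0 hexp.
  by rewrite subKr powRN mul1r.
by rewrite subr_ge0 t1 gtrDl oppr_lt0.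
Qed.

(** With g = 1/(b+1) and s = 1 - g, s * ln n <= n^s turns the factor n^(-g) into an exponential, so
    the right side is at least exp(-L * n^s). The left exponent is n^s * n^(g/2), which wins once
    n^(g/2) >= L; for smaller n, n^s is at most L^(2s/g) and the constant compensates. *)
Lemma exp_power_absorb (R : realType) (b K : R) : 0 < b -> 0 <= K ->
  exists2 c : R, 0 < c & forall n : R, 1 <= n ->
    c * expR (- n `^ (1 - (2 * (b + 1))^-1)) <=
    n `^ (- (b + 1)^-1) * expR (- (K * n `^ (1 - (b + 1)^-1))).
Proof.
move=> b0 K0; pose g := (b + 1)^-1; pose s := 1 - g.
have b1 : 0 < b + 1 by lra.
have g0 : 0 < g by rewrite invr_gt0.
have g1 : g < 1 by rewrite invf_lt1//; lra.
have s0 : 0 < s by rewrite subr_gt0.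
have -> : (2 * (b + 1))^-1 = g / 2 by rewrite invfM mulrC.
rewrite -/g -/s; pose L := K + g / s.
have L0 : 0 <= L by rewrite addr_ge0// ltW// divr_gt0.
exists (expR (- (L * L `^ (2 * s / g)))); first exact: expR_gt0.
move=> n n1; have n0 : 0 < n by lra.
pose y := n `^ (g / 2); pose x := n `^ s.
have x0 : 0 < x by rewrite powR_gt0.
have y0 : 0 <= y by rewrite powR_ge0.
have -> : n `^ (1 - g / 2) = x * y.
  rewrite /x /y -powRD; last by rewrite (gt_eqF n0) implybT.
  by congr powR; rewrite /s; lra.
have xy : x = y `^ (2 * s / g).
  by rewrite /x /y -powRrM; congr powR; field; rewrite gt_eqF.
have lnx : s * ln n <= x.
  rewrite -ln_powR -/x.
  have : ln (1 + (x - 1)) <= x - 1 by apply: le_ln1Dx; lra.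
  by rewrite addrCA subrr addr0; lra.
apply: (@le_trans _ _ (expR (- (L * x)))); last first.
  have -> : n `^ (- g) = expR (- (g * ln n)).
    by rewrite -[n in LHS](@lnK _ n) ?posrE// -expRM mulrC mulNr.
  rewrite -expRD ler_expR -opprD lerN2 /L mulrDl addrC lerD2l.
  by rewrite mulrAC ler_pdivlMr// mulrAC -mulrA ler_pM2l// mulrC.
rewrite -expRD ler_expR.
have [Ly|yL] := leP L y.
  have : 0 <= L * L `^ (2 * s / g) by rewrite mulr_ge0 ?powR_ge0.
  have : L * x <= y * x by rewrite ler_pM2r.
  by lra.
have : L * x <= L * L `^ (2 * s / g).
  rewrite ler_wpM2l// xy ge0_ler_powR ?nnegrE ?(ltW yL)//.
  by rewrite !mulr_ge0 ?invr_ge0 ?ltW.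
have := mulr_ge0 (ltW x0) y0; lra.
Qed.

Section Moments.
Variables (R : realType) (v : R[i]^o -> R).
Hypothesis hv : is_weight v.

Let I : set R := `[0, 1].

Let mI : measurable I.
Proof. exact: measurable_itv. Qed.

Lemma measurable_moment_integrand a :
  measurable_fun I (fun r => (r `^ a * profile v r)%:E).
Proof.
apply/measurable_EFinP/measurable_funM; last exact: measurable_profile.
by apply: measurable_funTS; exact: measurable_powR.
Qed.

Lemma moment_integrand_ge0 a r : I r -> (0 <= (r `^ a * profile v r)%:E)%E.
Proof.
rewrite /I /= in_itv /= => /andP[r0 _].
by rewrite lee_fin mulr_ge0 ?powR_ge0 ?profile_ge0.
Qed.

(* Restrict the integral to [1 - 2 d, 1 - d] with d = n^(-1/(beta+1)) / 4, the
   scale balancing n d against d^(-beta). *)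
Lemma moment_lower (alpha beta c n : R) :
  0 < alpha -> 0 < beta -> 0 < c -> exp_minorized (profile v) alpha beta c ->
  1 <= n ->
  ((c / 4 * (n `^ (- (beta + 1)^-1) * expR (- ((1 + alpha * 4 `^ beta) *
     n `^ (1 - (beta + 1)^-1)))))%:E <= moment v n)%E.
Proof.
move=> a0 b0 c0 hw n1; set g := (beta + 1)^-1; set s := 1 - g.
have n0 : 0 < n by lra.
have b1 : 0 < beta + 1 by lra.
have g0 : 0 < g by rewrite invr_gt0.
pose d := n `^ (- g) / 4.
have d0 : 0 < d by rewrite divr_gt0// powR_gt0.
have d4 : 4 * d <= 1.
  rewrite mulrC divfK// -(powRr0 n); apply: ler_powR => //.
  by rewrite oppr_le0 ltW.
have nd : 4 * (n * d) = n `^ s.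
  rewrite mulrC -mulrA divfK// -[n in n * _](powRr1 (ltW n0)) -powRD//.
  by rewrite (gt_eqF n0) implybT.
have db : d `^ (- beta) = 4 `^ beta * n `^ s.
  rewrite powRM ?powR_ge0 ?invr_ge0// -powRrM mulrNN mulrC; congr (_ * _).
    by rewrite -[4^-1]powR_inv1// -powRrM mulrNN mul1r.
  by congr powR; rewrite /s /g; field; rewrite gt_eqF.
set m := c / 4 * _.
have -> : m = c * expR (- ((1 + alpha * 4 `^ beta) * n `^ s)) * d.
  by rewrite /m /d; ring.
pose J : set R := `[1 - 2 * d, 1 - d]%classic.
have JI : J `<=` I.
  by move=> r; rewrite /J /I /= !in_itv /= => /andP[? ?]; apply/andP; split; lra.
have mJ : measurable J by exact: measurable_itv.
apply: (@le_trans _ _ (\int[lebesgue_measure]_(r in J) (r `^ n * profile v r)%:E)%E); last first.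
  apply: ge0_subset_integral => //; first exact: measurable_moment_integrand.
  by move=> r; exact: moment_integrand_ge0.
have muJ : lebesgue_measure J = d%:E.
  rewrite /J lebesgue_measure_itv /= lte_fin ifT; last by lra.
  by rewrite -EFinD; congr EFin; lra.
rewrite EFinM -muJ -integral_cst//.
apply: ge0_le_integral => //.
- by move=> r _; rewrite lee_fin mulr_ge0 ?expR_ge0// ltW.
- apply: measurable_funS JI _ => //; exact: measurable_moment_integrand.
move=> r; rewrite /J /= in_itv /= => /andP[r1 r2]; rewrite lee_fin.
(* The first summand bounds r^n through r >= 1 - 2d, the second bounds v(r) through r <= 1 - d. *)
have -> : - ((1 + alpha * 4 `^ beta) * n `^ s) =
    - (2 * (n * (2 * d))) + - (alpha * d `^ (- beta)) by rewrite db -nd; ring.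
rewrite expRD mulrCA; apply: ler_pM; rewrite ?expR_ge0//.
- by rewrite mulr_ge0 ?expR_ge0// ltW.
- apply: le_trans (powR_expR_bounds _ _ _) _; try lra.
  by apply: ge0_ler_powR; rewrite ?nnegrE//; lra.
- apply: le_trans (hw d d0 _) _; first by lra.
  by apply: profile_le => //; lra.
Qed.

(* Where r >= exp(-1/h), replacing r^(n-h) by r^n costs at most a factor e; below
   that point r^(n-h) <= e exp(-n/h). *)
Lemma moment_integrand_split (n h r : R) : 1 <= h -> h <= n -> I r ->
  r `^ (n - h) * profile v r <=
  expR 1 * (r `^ n * profile v r) + expR 1 * expR (- (n / h)) * profile v 0.
Proof.
move=> h1 hn; rewrite /I /= in_itv /= => /andP[r0 r1].
have h0 : 0 < h by lra.
have w0 : 0 <= profile v r by apply: profile_ge0.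
have [hr|hr] := leP (expR (- h^-1)) r.
  have rp : 0 < r by apply: lt_le_trans hr; exact: expR_gt0.
  apply: ler_wpDr.
    by rewrite !mulr_ge0 ?expR_ge0// profile_ge0.
  rewrite mulrA; apply: ler_wpM2r => //.
  have -> : r `^ n = r `^ h * r `^ (n - h).
    rewrite -powRD; last by rewrite (gt_eqF rp) implybT.
    by congr powR; ring.
  rewrite mulrA ler_peMl ?powR_ge0// -ler_pdivrMl ?expR_gt0// mulr1 -expRN.
  have -> : - 1 = - h^-1 * h by rewrite mulNr mulVf// gt_eqF.
  by rewrite expRM ge0_ler_powR ?nnegrE ?expR_ge0// ltW.
apply: ler_wpDl; first by rewrite !mulr_ge0 ?expR_ge0 ?powR_ge0.
apply: ler_pM; rewrite ?powR_ge0//; last by apply: profile_le.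
apply: (@le_trans _ _ (expR (- h^-1) `^ (n - h))).
  by rewrite ge0_ler_powR ?nnegrE ?expR_ge0 ?subr_ge0// ltW.
rewrite -expRM -expRD ler_expR.
have -> : - h^-1 * (n - h) = 1 - n / h by field; rewrite gt_eqF.
by [].
Qed.

Lemma moment_upper (n h : R) : 1 <= h -> h <= n ->
  (moment v (n - h) <= (expR 1)%:E * moment v n +
     (expR 1 * expR (- (n / h)) * profile v 0)%:E)%E.
Proof.
move=> h1 hn.
have k0 : 0 <= expR 1 * expR (- (n / h)) * profile v 0.
  by rewrite !mulr_ge0 ?expR_ge0// profile_ge0.
have muI : lebesgue_measure I = 1%E.
  by rewrite /I lebesgue_measure_itv /= lte_fin ltr01 sube0.
have mm := measurable_moment_integrand n.
rewrite /moment -/I.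
rewrite -[X in (_ + X)%E]mule1 -muI -integral_cst//.
rewrite -ge0_integralZl_EFin ?expR_ge0//; last first.
  by move=> r; exact: moment_integrand_ge0.
rewrite -ge0_integralD//; last 2 first.
- move=> r Ir; apply: mule_ge0; first by rewrite lee_fin expR_ge0.
  exact: moment_integrand_ge0.
- exact: measurable_funeM.
apply: ge0_le_integral => //.
- by move=> r; exact: moment_integrand_ge0.
- exact: measurable_moment_integrand.
- by apply: emeasurable_funD => //; exact: measurable_funeM.
by move=> r Ir; rewrite -EFinM -EFinD lee_fin; exact: moment_integrand_split.
Qed.

Lemma moment_lty (n : R) : 0 <= n -> (moment v n < +oo)%E.
Proof.
move=> n0; have muI : lebesgue_measure I = 1%E.
  by rewrite /I lebesgue_measure_itv /= lte_fin ltr01 sube0.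
apply: (@le_lt_trans _ _ (profile v 0)%:E); last exact: ltry.
rewrite -[leRHS]mule1 -muI -integral_cst//.
apply: ge0_le_integral => //.
- by move=> r; exact: moment_integrand_ge0.
- exact: measurable_moment_integrand.
move=> r; rewrite /I /= in_itv /= => /andP[r0 r1]; rewrite lee_fin -[leRHS]mul1r.
apply: ler_pM; rewrite ?powR_ge0 ?profile_ge0 ?profile_le//.
by have := ge0_ler_powR n0 _ _ r1; rewrite powR1; apply; rewrite nnegrE.
Qed.

(** Halving the exponent 1/(beta+1) to get e makes n^(1-e) outgrow the n^(1-1/(beta+1)) of
    [moment_lower]. With h = n^e the remainder in [moment_upper] is a multiple of exp(-n^(1-e)),
    hence of the moment itself. *)
Lemma exp_minorized_moment_condition (alpha beta c : R) :
  0 < alpha -> 0 < beta -> 0 < c -> exp_minorized (profile v) alpha beta c ->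
  moment_condition v.
Proof.
move=> a0 b0 c0 hw.
have [|c2 c20 absorb] := @exp_power_absorb R beta (1 + alpha * 4 `^ beta) b0.
  by rewrite addr_ge0// mulr_ge0 ?powR_ge0// ltW.
pose e := (2 * (beta + 1))^-1.
have e0 : 0 < e by rewrite invr_gt0; lra.
have e1 : e <= 1 by rewrite invf_le1; lra.
exists e => //.
pose B := expR 1 + expR 1 * profile v 0 / (c / 4 * c2).
apply: (@le_lt_trans _ _ B%:E); last exact: ltry.
apply: ge_ereal_sup => _ [n /= n1 <-].
have nR1 : 1 <= n%:R :> R by rewrite ler1n.
have n0 : 0 < n%:R :> R by rewrite ltr0n.
set h := n%:R `^ e.
have h1 : 1 <= h by rewrite -(powRr0 n%:R) ler_powR// ltW.
have hn : h <= n%:R by rewrite -[leRHS]powRr1 ?ler_powR.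
have nh : n%:R / h = n%:R `^ (1 - e).
  rewrite powRD ?powRN ?powRr1//.
  by rewrite (gt_eqF n0) implybT.
have low := moment_lower a0 b0 c0 hw nR1.
have fin := moment_lty (ltW n0).
have up := moment_upper h1 hn.
(* The denominator is finite, and positive by [low], so the extended-real quotient can be cleared as
   a real one. *)
move: low fin up; case: (moment v n%:R) => [M| |]//; rewrite lee_fin => low _ up.
have {}low : c / 4 * c2 * expR (- (n%:R / h)) <= M.
  apply: le_trans low; rewrite nh -mulrA; apply: ler_wpM2l; last exact: absorb.
  by rewrite divr_ge0// ltW.
have k0 : 0 < c / 4 * c2 by rewrite mulr_gt0// divr_gt0.
have M0 : 0 < M by apply: lt_le_trans low; rewrite mulr_gt0 ?expR_gt0.
rewrite inver gt_eqF// lee_pdivrMr//; apply: (le_trans up).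
rewrite -!EFinM -EFinD lee_fin /B mulrDl lerD2l.
have w0 : 0 <= profile v 0 by apply: profile_ge0.
have -> : expR 1 * expR (- (n%:R / h)) * profile v 0 =
  expR 1 * profile v 0 / (c / 4 * c2) * (c / 4 * c2 * expR (- (n%:R / h))).
  by field; rewrite !gt_eqF.
apply: ler_wpM2l => //; rewrite divr_ge0 ?(ltW k0)//.
by rewrite mulr_ge0 ?expR_ge0.
Qed.

End Moments.

Theorem proposition1p3 (R : realType) (v : R[i]^o -> R) (hv : is_weight v)
    (hne : is_normal v \/
           exists alpha beta : R,
             [/\ 0 < alpha, 0 < beta & is_exponential alpha beta v]) :
  condition_B v /\ moment_condition v.
Proof.
case: hne => [hn|[alpha [beta [a0 b0 hexp]]]]; split.
- exact: normal_condition_B.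
- have [alpha [c [a0 c0 hw]]] := normal_exp_minorized hv hn.
  exact: exp_minorized_moment_condition hv _ _ _ a0 ltr01 c0 hw.
- exact: exponential_condition_B hexp.
- exact: exp_minorized_moment_condition hv _ _ _ a0 b0 ltr01
    (exponential_exp_minorized hexp).
Qed.
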